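(* Let $f\in C(\Omega)$ with $f\ge 0$ in $\Omega$. If $u$ is a viscosity subsolution (resp. supersolution) of the Monge–Ampère equation $M(D^2u(x),f(x))=0$ in $\Omega$ on the set of convex functions, then $u$ is a viscosity subsolution (resp. supersolution) of the Bellman equation $H(D^2u(x),f(x))=0$ in $\Omega$.
   Context: Let $d\ge 2$ and let $\Omega\subset\mathbb R^d$ be a bounded open strictly convex domain. $\mathbb S$ denotes the set of real symmetric $d\times d$ matrices, $\mathbb S_+=\{A\in\mathbb S: A\ge 0\}$ (positive semidefinite matrices), $\mathbb S_1=\{B\in\mathbb S_+:\operatorname{tr}B=1\}$, and $A:B=\operatorname{tr}(A^TB)$ is the Frobenius inner product. For $A\in\mathbb S$ and $f\in[0,\infty)$ define the Bellman operator $H(A,f)=\sup_{B\in\mathbb S_1}\bigl(-B:A+f\sqrt[d]{\det B}\bigr)$ and the Monge–Ampère operator $M(A,f)=(f/d)^d-\det A$. $\mathrm{USC}(G)$, $\mathrm{LSC}(G)$ denote upper/lower semicontinuous functions on $G$. Viscosity notions: for $F:\mathbb S\times\Omega\to\mathbb R$ (here $F(A,x)=H(A,f(x))$ or $F(A,x)=M(A,f(x))$), a function $u\in\mathrm{USC}(\Omega)$ (resp. $u\in\mathrm{LSC}(\Omega)$) is a viscosity subsolution (resp. supersolution) of $F(D^2u(x),x)=0$ in $\Omega$ if for every $\varphi\in C^2(\Omega)$ such that $u-\varphi$ has a local maximum (resp. minimum) at $x\in\Omega$ one has $F(D^2\varphi(x),x)\le 0$ (resp. $\ge 0$); a viscosity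 solution is both a sub- and a supersolution. The function $u$ is a viscosity subsolution (resp. supersolution) on the set of convex functions if $u$ is convex and the same inequality holds for every convex $\varphi\in C^2(\Omega)$ such that $u-\varphi$ has a local maximum (resp. minimum) at $x\in\Omega$; a viscosity solution on the set of convex functions is both. *)

(* Defs.v *)
From Stdlib Require Import Reals ClassicalEpsilon.
From mathcomp Require Import all_boot fingroup perm.
Set Implicit Arguments. Unset Strict Implicit. Unset Printing Implicit Defensive.

Local Open Scope R_scope.

Definition pt (d : nat) := 'I_d -> R.
Definition mat (d : nat) := 'I_d -> 'I_d -> R.

Definition sumR (d : nat) (F : 'I_d -> R) : R := \big[Rplus/0]_(i < d) F i.

Definition frob (d : nat) (A B : mat d) : R :=
  sumR (fun i => sumR (fun j => A i j * B i j)).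

Definition trace (d : nat) (A : mat d) : R := sumR (fun i => A i i).

Definition det (d : nat) (A : mat d) : R :=
  \big[Rplus/0]_(s : 'S_d)
     ((if odd_perm s then -1 else 1) * \big[Rmult/1]_(i < d) A i (s i)).

Definition symmetric (d : nat) (A : mat d) : Prop := forall i j, A i j = A j i.

Definition psd (d : nat) (A : mat d) : Prop :=
  symmetric A /\
  forall v : pt d, 0 <= sumR (fun i => sumR (fun j => v i * A i j * v j)).

Definition S1 (d : nat) (B : mat d) : Prop := psd B /\ trace B = 1.

Definition root (d : nat) (x : R) : R :=
  if Rle_dec x 0 then 0 else Rpower x (/ INR d).

Definition Hval (d : nat) (A : mat d) (f : R) (B : mat d) : R :=
  - frob B A + f * root d (det B).

Definition Hop (d : nat) (A : mat d) (f : R) : R :=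
  epsilon (inhabits 0)
    (fun s => is_lub (fun r => exists B : mat d, S1 B /\ r = Hval A f B) s).

Definition Mop (d : nat) (A : mat d) (f : R) : R := (f / INR d) ^ d - det A.

Definition norm2 (d : nat) (x : pt d) : R := sqrt (sumR (fun i => x i * x i)).
Definition dist (d : nat) (x y : pt d) : R := norm2 (fun i => x i - y i).

Definition nonempty_set (d : nat) (Om : pt d -> Prop) : Prop := exists x, Om x.
Definition open_dom (d : nat) (Om : pt d -> Prop) : Prop :=
  forall x, Om x -> exists r, 0 < r /\ forall y, dist y x < r -> Om y.
Definition bounded_dom (d : nat) (Om : pt d -> Prop) : Prop :=
  exists M, forall x, Om x -> norm2 x <= M.
Definition closure (d : nat) (Om : pt d -> Prop) (x : pt d) : Prop :=
  forall e, 0 < e -> exists y, Om y /\ dist y x < e.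
Definition lin (d : nat) (x y : pt d) (t : R) : pt d :=
  fun i => (1 - t) * x i + t * y i.
Definition strictly_convex_domain (d : nat) (Om : pt d -> Prop) : Prop :=
  forall x y t, closure Om x -> closure Om y -> x <> y -> 0 < t < 1 ->
    Om (lin x y t).

Definition cont_on (d : nat) (Om : pt d -> Prop) (g : pt d -> R) : Prop :=
  forall x, Om x -> forall e, 0 < e -> exists del, 0 < del /\
    forall y, Om y -> dist y x < del -> Rabs (g y - g x) < e.
Definition usc_on (d : nat) (Om : pt d -> Prop) (g : pt d -> R) : Prop :=
  forall x, Om x -> forall e, 0 < e -> exists del, 0 < del /\
    forall y, Om y -> dist y x < del -> g y < g x + e.
Definition lsc_on (d : nat) (Om : pt d -> Prop) (g : pt d -> R) : Prop :=
  forall x, Om x -> forall e, 0 < e -> exists del, 0 < del /\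
    forall y, Om y -> dist y x < del -> g x - e < g y.

Definition convex_fun_on (d : nat) (Om : pt d -> Prop) (g : pt d -> R) : Prop :=
  forall x y t, Om x -> Om y -> 0 <= t <= 1 ->
    g (lin x y t) <= (1 - t) * g x + t * g y.

Definition evec (d : nat) (i : 'I_d) : pt d := fun k => if k == i then 1 else 0.
Definition partial_at (d : nat) (g : pt d -> R) (i : 'I_d) (x : pt d) (l : R) : Prop :=
  derivable_pt_lim (fun t => g (fun k => x k + t * evec i k)) 0 l.

Definition C2_on (d : nat) (Om : pt d -> Prop) (phi : pt d -> R)
    (Dphi : 'I_d -> pt d -> R) (D2phi : pt d -> mat d) : Prop :=
  (forall x i, Om x -> partial_at phi i x (Dphi i x)) /\
  (forall x i j, Om x -> partial_at (Dphi i) j x (D2phi x i j)) /\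
  cont_on Om phi /\
  (forall i, cont_on Om (Dphi i)) /\
  (forall i j, cont_on Om (fun x => D2phi x i j)).

Definition loc_max (d : nat) (Om : pt d -> Prop) (g : pt d -> R) (x : pt d) : Prop :=
  exists r, 0 < r /\ forall y, Om y -> dist y x < r -> g y <= g x.
Definition loc_min (d : nat) (Om : pt d -> Prop) (g : pt d -> R) (x : pt d) : Prop :=
  exists r, 0 < r /\ forall y, Om y -> dist y x < r -> g x <= g y.

Definition visc_sub (d : nat) (Om : pt d -> Prop) (F : mat d -> pt d -> R)
    (u : pt d -> R) : Prop :=
  usc_on Om u /\
  forall phi Dphi D2phi x, C2_on Om phi Dphi D2phi -> Om x ->
    loc_max Om (fun y => u y - phi y) x -> F (D2phi x) x <= 0.
Definition visc_super (d : nat) (Om : pt d -> Prop) (F : mat d -> pt d -> R)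
    (u : pt d -> R) : Prop :=
  lsc_on Om u /\
  forall phi Dphi D2phi x, C2_on Om phi Dphi D2phi -> Om x ->
    loc_min Om (fun y => u y - phi y) x -> 0 <= F (D2phi x) x.

Definition visc_sub_convex (d : nat) (Om : pt d -> Prop) (F : mat d -> pt d -> R)
    (u : pt d -> R) : Prop :=
  usc_on Om u /\ convex_fun_on Om u /\
  forall phi Dphi D2phi x, C2_on Om phi Dphi D2phi -> convex_fun_on Om phi -> Om x ->
    loc_max Om (fun y => u y - phi y) x -> F (D2phi x) x <= 0.
Definition visc_super_convex (d : nat) (Om : pt d -> Prop) (F : mat d -> pt d -> R)
    (u : pt d -> R) : Prop :=
  lsc_on Om u /\ convex_fun_on Om u /\
  forall phi Dphi D2phi x, C2_on Om phi Dphi D2phi -> convex_fun_on Om phi -> Om x ->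
    loc_min Om (fun y => u y - phi y) x -> 0 <= F (D2phi x) x.

(* Main.v *)
From Stdlib Require Import Reals Lra FunctionalExtensionality Classical ClassicalEpsilon.
From mathcomp Require Import all_boot all_order all_algebra perm.
From mathcomp Require Import Rstruct.
From mathcomp Require ring lra.
Require Import Defs.

(* Let A be the symmetric part of the Hessian of a test function phi at x. By
   Taylor, the quadratic q_s with the 1-jet of phi at x and Hessian A + s I
   touches phi at x from above if s > 0 and from below if s < 0.

   Subsolutions: q_e touches the convex u from above, so A + e I >= 0, hence
   q_e is a convex test function and (f/d)^d <= det (A + e I). For psd matrices
   (tr (A B) / d)^d >= det A det B (Cholesky, Hadamard and AM-GM), which gives
   - B:A + f (det B)^(1/d) <= e for every B of trace 1.

   Supersolutions: if A - e I is not psd, some v has v^T A v < e |v|^2 and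
   B = v v^T / |v|^2 gives H >= - e. Otherwise C = A - (e/2) I is positive
   definite, so the corresponding quadratic is convex and det C <= (f/d)^d, and
   B = C^-1 / tr C^-1 gives H >= - e/2. *)

Set Implicit Arguments. Unset Strict Implicit. Unset Printing Implicit Defensive.

Import Order.TTheory GRing.Theory Num.Theory.

(** * Positive semidefinite matrices: Cholesky factors, determinants and traces *)

Section PositiveSemidefinite.
Import mathcomp.algebra_tactics.ring mathcomp.algebra_tactics.lra.
Local Open Scope ring_scope.
Variable K : rcfType.
Implicit Types n : nat.

(** Counterpart of [psd] for library matrices, linked to it by [psd_mx]. The field is real closed
    because the Cholesky factor needs square roots. *)
Definition psdmx n (A : 'M[K]_n) : Prop :=
  A^T = A /\ forall v : 'rV_n, 0 <= (v *m A *m v^T) 0 0.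

(** Splits off the first coordinate [c], so that the form becomes a quadratic polynomial in [c]
    whose coefficients can be compared. *)
Lemma psdmx_block n (a : K) (b : 'cV[K]_n) (D : 'M[K]_n) (c : K) (v : 'rV_n) :
  (row_mx c%:M v *m block_mx a%:M b^T b D *m (row_mx c%:M v)^T) 0 0 =
  a * c ^+ 2 + 2 * c * (v *m b) 0 0 + (v *m D *m v^T) 0 0.
Proof.
rewrite tr_row_mx mul_row_block mul_row_col tr_scalar_mx !mulmxDl.
rewrite ![(_ + _ : 'M_(_, _)) _ _]mxE.
have -> : (v *m b *m c%:M) 0 0 = c * (v *m b) 0 0.
  by rewrite mul_mx_scalar mxE.
have -> : (c%:M *m b^T *m v^T) 0 0 = c * (v *m b) 0 0.
  by rewrite mul_scalar_mx -scalemxAl mxE -trmx_mul mxE.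
have -> : ((c%:M : 'M_1) *m a%:M *m c%:M) 0 0 = a * c ^+ 2.
  by rewrite -!scalar_mxM mxE eqxx mulr1n; ring.
ring.
Qed.

(** Induction on the size: the first column of the factor is [Num.sqrt a] above [b] divided by
    [Num.sqrt a], and the rest factors the Schur complement. A semidefinite matrix may have the
    pivot [a = 0]; then [b = 0], and since the inverse of 0 is 0 the same formulas remain valid. *)
Lemma psdmx_cholesky n (A : 'M[K]_n) :
  psdmx A -> exists2 L : 'M[K]_n, is_trig_mx L & A = L *m L^T.
Proof.
elim: n A => [|n IHn] A.
  by move=> _; exists 0; [apply/is_trig_mxP => -[] | rewrite [LHS]flatmx0 [RHS]flatmx0].
rewrite -[n.+1]/(1 + n)%N in A *.
rewrite -(submxK A) (mx11_scalar (ulsubmx A)).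
set a := ulsubmx A 0 0; set b := dlsubmx A; set D := drsubmx A.
rewrite {1}/psdmx tr_block_mx.
case=> /eq_block_mx[_ <- _ DT] Apos; clearbody a b D.
have qpos c (v : 'rV_n) : 0 <= a * c ^+ 2 + 2 * c * (v *m b) 0 0 + (v *m D *m v^T) 0 0.
  by have := Apos (row_mx c%:M v); rewrite psdmx_block.
have a_ge0 : 0 <= a.
  by have := qpos 1 0; rewrite !mul0mx !mxE; lra.
have b0 : a = 0 -> b = 0.
  move=> a0; apply/matrixP => i j; rewrite ord1 mxE.
  set x := b i 0; set y := D i i.
  (* With [a = 0] the form at [c] and the i-th basis vector is [2 * c * x + y]. This [c] makes it
     [- y - 2], which is negative because [y] is a nonnegative diagonal entry. *)
  have := qpos (- (y + 1) / x) (delta_mx 0 i).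
  rewrite -!rowE trmx_delta -colE !mxE -/x -/y a0 !mul0r !add0r => h.
  apply/eqP/contraT => x0; move: h.
  have -> : 2 * (- (y + 1) / x) * x = - 2 * (y + 1) by field.
  have := qpos 0 (delta_mx 0 i).
  rewrite -!rowE trmx_delta -colE !mxE -/y;   lra.
have [|L Ltrig EL] := IHn (D - a^-1 *: (b *m b^T)).
  split=> [|v].
    by rewrite linearB linearZ /= trmx_mul trmxK DT.
  have -> : (v *m (D - a^-1 *: (b *m b^T)) *m v^T) 0 0 =
            (v *m D *m v^T) 0 0 - a^-1 * (v *m b) 0 0 ^+ 2.
    rewrite mulmxBr mulmxBl -scalemxAr -scalemxAl.
    rewrite [LHS]mxE [X in _ + X]mxE [X in - X]mxE; congr (_ - _ * _).
    rewrite (mulmxA v) -(mulmxA (v *m b)) -trmx_mul (mx11_scalar (v *m b)) tr_scalar_mx.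
    by rewrite -scalar_mxM !mxE eqxx !mulr1n expr2.
  (* For [a] nonzero this [c] minimises the form in its first coordinate, and the minimum is the
     form of the Schur complement at [v]. *)
  have := qpos (- (a^-1) * (v *m b) 0 0) v.
  have [->|a0] := eqVneq a 0; first by rewrite invr0; nra.
  suff -> : a * (- a^-1 * (v *m b) 0 0) ^+ 2 +
    2 * (- a^-1 * (v *m b) 0 0) * (v *m b) 0 0 = - (a^-1 * (v *m b) 0 0 ^+ 2).
    lra.
  by field.
exists (block_mx (Num.sqrt a)%:M 0 ((Num.sqrt a)^-1 *: b) L).
  by rewrite is_trig_block_mx // eqxx Ltrig scalar_mx_is_trig.
rewrite tr_block_mx mulmx_block !tr_scalar_mx !trmx0 !mulmx0 !mul0mx !addr0.
have sE : Num.sqrt a * Num.sqrt a = a by rewrite -expr2 sqr_sqrtr.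
have bE : ((Num.sqrt a)^-1 * Num.sqrt a) *: b = b.
  have [a0|a0] := eqVneq a 0; first by rewrite b0 // scaler0.
  by rewrite mulVf ?scale1r // sqrtr_eq0 -ltNge lt_def a0.
congr block_mx.
- by rewrite -scalar_mxM sE.
- by rewrite -{1}bE !linearZ /= mul_scalar_mx scalerA mulrC.
- by rewrite mul_mx_scalar scalerA mulrC bE.
- by rewrite -EL linearZ /= -scalemxAr -scalemxAl scalerA -invfM sE addrC subrK.
Qed.

Lemma det_cholesky n (L : 'M[K]_n) : \det (L *m L^T) = \det L ^+ 2.
Proof. by rewrite det_mulmx det_tr expr2. Qed.

Lemma psdmx_det_ge0 n (A : 'M[K]_n) : psdmx A -> 0 <= \det A.
Proof. by move=> /psdmx_cholesky[L _ ->]; rewrite det_cholesky sqr_ge0. Qed.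

(* With A = L L^T and L triangular, det A is the product of the L_ii^2 and
   L_ii^2 <= A_ii (Hadamard); then AM-GM. *)
Lemma psdmx_det_le_trace n (A : 'M[K]_n) :
  psdmx A -> 0 <= \tr A /\ \det A <= (\tr A / n%:R) ^+ n.
Proof.
move=> /psdmx_cholesky[L Ltrig ->]; rewrite det_cholesky det_trig //.
have dE i : (L *m L^T) i i = \sum_j L i j ^+ 2.
  by rewrite mxE; apply: eq_bigr => j _; rewrite mxE expr2.
have d_ge i : L i i ^+ 2 <= (L *m L^T) i i.
  by rewrite dE (bigD1 i) //= lerDl sumr_ge0 // => j _; rewrite sqr_ge0.
have d_ge0 i : 0 <= (L *m L^T) i i by apply: le_trans (d_ge i); rewrite sqr_ge0.
split; first exact: sumr_ge0.
rewrite -prodrXl.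
apply: (@le_trans _ _ (\prod_(i < n) (L *m L^T) i i)).
  by apply: ler_prod => i _; rewrite sqr_ge0 d_ge.
have := leif_AGM (A := 'I_n) (E := fun i => (L *m L^T) i i) (fun i _ => d_ge0 i).
by rewrite card_ord; case.
Qed.

Lemma psdmx_congr n (A M : 'M[K]_n) : psdmx A -> psdmx (M^T *m A *m M).
Proof.
case=> AT Apos; split=> [|v]; first by rewrite !trmx_mul trmxK AT mulmxA.
by have := Apos (v *m M^T); rewrite trmx_mul trmxK !mulmxA.
Qed.

(** Write [B = L *m L^T] and apply the one-matrix bound to [L^T *m A *m L]: its determinant is
    [\det A * \det B], and its trace is [\tr (A *m B)] by cyclicity. *)
Lemma psdmx_det_mul_le_trace n (A B : 'M[K]_n) : psdmx A -> psdmx B ->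
  0 <= \tr (A *m B) /\ \det A * \det B <= (\tr (A *m B) / n%:R) ^+ n.
Proof.
move=> Apsd /psdmx_cholesky[L _ ->].
have [] := psdmx_det_le_trace (psdmx_congr L Apsd).
by rewrite !det_mulmx det_tr mxtrace_mulC !mulmxA [_ * \det A]mulrC !mulrA
  mxtrace_mulC !mulmxA.
Qed.

Lemma psdmx_mul_tr n m (M : 'M[K]_(n, m)) : psdmx (M *m M^T).
Proof.
split=> [|v]; first by rewrite trmx_mul trmxK.
rewrite (mulmxA v) -(mulmxA (v *m M)) -trmx_mul mxE sumr_ge0 // => i _.
by rewrite [_^T _ _]mxE -expr2 sqr_ge0.
Qed.

(** The inverse of [L *m L^T] is again a product of a matrix with its transpose, the matrix being
    the transposed inverse of [L]. *)
Lemma psdmx_inv n (A : 'M[K]_n) :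
  psdmx A -> A \in unitmx -> psdmx (invmx A).
Proof.
move=> /psdmx_cholesky[L _ ->]; rewrite unitmx_mul unitmx_tr => /andP[Lu _].
have -> : invmx (L *m L^T) = (invmx L)^T *m ((invmx L)^T)^T.
  have LLu : L *m L^T \in unitmx by rewrite unitmx_mul unitmx_tr Lu.
  apply: (can_inj (mulKmx LLu)); rewrite mulmxV // trmxK !mulmxA.
  by rewrite -(mulmxA L) -trmx_mul mulVmx // trmx1 mulmx1 mulmxV.
exact: psdmx_mul_tr.
Qed.

Lemma psdmx_scale n (c : K) (A : 'M[K]_n) : 0 <= c -> psdmx A -> psdmx (c *: A).
Proof.
move=> c0 [AT Apos]; split=> [|v]; first by rewrite linearZ /= AT.
by rewrite -scalemxAr -scalemxAl mxE mulr_ge0.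
Qed.

Lemma psdmx_scalar n (c : K) : 0 <= c -> psdmx (c%:M : 'M[K]_n).
Proof.
move=> c0; rewrite -scalemx1; apply: psdmx_scale => //.
by have := psdmx_mul_tr (1%:M : 'M[K]_n); rewrite trmx1 mulmx1.
Qed.

(** If [A] were singular, a nonzero [v] with [v *m A = 0] would give the shifted form the value
    [- e] times the squared norm of [v], which is negative. *)
Lemma psdmx_det_gt0 n (A : 'M[K]_n) (e : K) :
  0 < e -> psdmx (A - e%:M) -> 0 < \det A.
Proof.
move=> e0 [AT Apos].
have Apsd : psdmx A.
  rewrite -(subrK e%:M A); have [eT epos] := @psdmx_scalar n e (ltW e0).
  split=> [|v]; first by rewrite linearD /= AT eT.
  by rewrite mulmxDr mulmxDl mxE addr_ge0.
rewrite lt_def psdmx_det_ge0 // andbT; apply/det0P => -[v v0 vA].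
have := Apos v; rewrite mulmxBr vA sub0r mulNmx mxE oppr_ge0 mul_mx_scalar.
rewrite -scalemxAl mxE pmulr_rle0 // mxE => s_le0; case/negP: v0.
apply/eqP/rowP => i; rewrite mxE; apply/eqP; rewrite -sqrf_eq0.
rewrite eq_le sqr_ge0 andbT; apply: le_trans s_le0.
rewrite (bigD1 i) //= mxE -expr2 lerDl sumr_ge0 // => j _.
by rewrite mxE -expr2 sqr_ge0.
Qed.

(* The maximiser in the Bellman operator is the normalised inverse of A. *)
Lemma psdmx_dual n (A : 'M[K]_n) : (0 < n)%N -> psdmx A -> 0 < \det A ->
  exists B : 'M[K]_n, exists t : K, [/\ psdmx B, \tr B = 1, 0 < t,
    \tr (B *m A) = n%:R * t & \det B * \det A = t ^+ n].
Proof.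
move=> n0 Apsd dA; have Au : A \in unitmx by rewrite unitmxE unitfE gt_eqF.
have Ipsd := psdmx_inv Apsd Au.
have [tr_ge0 det_le] := psdmx_det_le_trace Ipsd.
(* A zero trace would force the positive determinant of [invmx A] below [0 ^+ n], which is 0 because
   [n] is positive. *)
have tr_gt0 : 0 < \tr (invmx A).
  rewrite lt_def tr_ge0 andbT; apply: contraTneq det_le => ->.
  by rewrite mul0r expr0n eqn0Ngt n0 -ltNge det_inv invr_gt0.
exists ((\tr (invmx A))^-1 *: invmx A), (\tr (invmx A))^-1; split.
- by apply: psdmx_scale => //; rewrite invr_ge0.
- by rewrite mxtraceZ mulVf // gt_eqF.
- by rewrite invr_gt0.
- by rewrite -scalemxAl mulVmx // mxtraceZ mxtrace1 mulrC.
- by rewrite detZ det_inv mulfVK // gt_eqF.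
Qed.

End PositiveSemidefinite.

Local Open Scope R_scope.

(** * Finite sums of real numbers *)

Section FiniteSums.
Variable d : nat.
Implicit Types F G : 'I_d -> R.

Lemma sumR_ext F G : (forall i, F i = G i) -> sumR F = sumR G.
Proof. by move=> FG; apply: eq_bigr => i _. Qed.

Lemma sumR_add F G : sumR F + sumR G = sumR (fun i => F i + G i).
Proof. by rewrite /sumR big_split. Qed.

Lemma sumR_scal c F : c * sumR F = sumR (fun i => c * F i).
Proof. exact: mulr_sumr. Qed.

Lemma sumR_sub F G : sumR F - sumR G = sumR (fun i => F i - G i).
Proof. exact/esym/sumrB. Qed.

Lemma sumR_exchange (F : 'I_d -> 'I_d -> R) :
  sumR (fun i => sumR (fun j => F i j)) = sumR (fun j => sumR (fun i => F i j)).
Proof. exact: exchange_big. Qed.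

Lemma sumR_const c : sumR (fun _ : 'I_d => c) = INR d * c.
Proof.
rewrite INRE; apply: etrans (sumr_const 'I_d c) _.
by rewrite card_ord; exact: esym (mulr_natl c d).
Qed.

Lemma sumR_le F G : (forall i, F i <= G i) -> sumR F <= sumR G.
Proof. by move=> FG; apply/RleP/ler_sum => i _; apply/RleP. Qed.

Lemma sumR_ge0 F : (forall i, 0 <= F i) -> 0 <= sumR F.
Proof. by move=> F0; apply/RleP/sumr_ge0 => i _; apply/RleP. Qed.

Lemma Rabs_sumR F : Rabs (sumR F) <= sumR (fun i => Rabs (F i)).
Proof. by apply/RleP; rewrite RabsE; apply: (ler_norm_sum (index_enum _) F xpredT). Qed.

Lemma sumR_ge_term F i : (forall i, 0 <= F i) -> F i <= sumR F.
Proof.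
move=> F0; rewrite /sumR (bigD1 i) //=.
suff: 0 <= \big[Rplus/0]_(j < d | j != i) F j.
  by move=> h; rewrite -[X in X <= _]Rplus_0_r; apply: Rplus_le_compat_l.
by apply/RleP/sumr_ge0 => j _; apply/RleP.
Qed.

Lemma sumR_evec i F : sumR (fun k => evec i k * F k) = F i.
Proof.
rewrite /sumR (bigD1 i) //= big1 /evec ?eqxx; first by move=> /=; lra.
by move=> k /negbTE ->; lra.
Qed.

End FiniteSums.

(** * Derivatives along lines and the second-order Taylor expansion *)

Section Lines.
Variable d : nat.
Implicit Types (x v h : pt d) (s t : R) (Om : pt d -> Prop).

Definition line x v t : pt d := fun k => x k + t * v k.

(** The same expression as in [psd], so that it can be folded there. *)
Definition quad (A : mat d) v : R :=
  sumR (fun i => sumR (fun j => v i * A i j * v j)).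

Lemma norm2_ge0 v : 0 <= norm2 v.
Proof. exact: sqrt_pos. Qed.

Lemma norm2_sqr v : norm2 v ^ 2 = sumR (fun i => v i * v i).
Proof. by apply: pow2_sqrt; apply: sumR_ge0 => i; nra. Qed.

Lemma norm2_le v w : (forall i, Rabs (v i) <= Rabs (w i)) -> norm2 v <= norm2 w.
Proof.
move=> vw; apply: sqrt_le_1_alt; apply: sumR_le => i.
exact: Rsqr_le_abs_1.
Qed.

Lemma Rabs_le_norm2 v i : Rabs (v i) <= norm2 v.
Proof.
rewrite -sqrt_Rsqr_abs; apply: sqrt_le_1_alt.
by apply: (sumR_ge_term (F := fun i => v i * v i)) => j; nra.
Qed.

Lemma norm2_scal t v : norm2 (fun k => t * v k) = Rabs t * norm2 v.
Proof.
rewrite -sqrt_Rsqr_abs -sqrt_mult_alt; last exact: Rle_0_sqr.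
by congr sqrt; rewrite sumR_scal; apply: sumR_ext => i; rewrite /Rsqr; ring.
Qed.

Lemma dist_add x v : dist (fun k => x k + v k) x = norm2 v.
Proof. by congr norm2; apply: functional_extensionality => k; ring. Qed.

Lemma dist_line x v t : dist (line x v t) x = Rabs t * norm2 v.
Proof. by rewrite (dist_add x (fun k => t * v k)) norm2_scal. Qed.

Lemma dist_line_le x v t r :
  norm2 v < r -> Rabs t <= 1 -> dist (line x v t) x < r.
Proof. by rewrite dist_line; have := norm2_ge0 v; nra. Qed.

Lemma line0 x v : line x v 0 = x.
Proof. by apply: functional_extensionality => k; rewrite /line; ring. Qed.

Lemma line_line x v s t : line (line x v s) v t = line x v (s + t).
Proof. by apply: functional_extensionality => k; rewrite /line; ring. Qed.

Lemma line_sub x y : line x (fun k => y k - x k) 1 = y.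
Proof. by apply: functional_extensionality => k; rewrite /line; ring. Qed.

(** The minimum of finitely many radii; it makes the continuity of all partial derivatives uniform
    in their indices. *)
Lemma common_radius (I : finType) (Q : I -> R -> Prop) :
  (forall i r s, Q i r -> s <= r -> Q i s) ->
  (forall i, exists r, 0 < r /\ Q i r) -> exists r, 0 < r /\ forall i, Q i r.
Proof.
move=> Qmono Qex.
suff [r [r0 Qr]] : exists r, 0 < r /\ forall i, i \in enum I -> Q i r.
  by exists r; split=> // i; apply: Qr; rewrite mem_enum.
elim: (enum I) => [|i s [r [r0 Qr]]]; first by exists 1; split=> //; lra.
have [r' [r'0 Qr']] := Qex i.
exists (Rmin r r'); split=> [|j]; first exact: Rmin_pos.
rewrite inE => /orP[/eqP->|js]; first by apply: Qmono Qr' _; apply: Rmin_r.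
by apply: Qmono (Qr _ js) _; apply: Rmin_l.
Qed.

(** Chain rule for an affine change of parameter. Partial derivatives are limits at parameter 0, and
    this carries them to any [t0]. *)
Lemma derivable_pt_lim_shift (g : R -> R) a t0 l :
  derivable_pt_lim (fun s => g (a * t0 + s)) 0 l ->
  derivable_pt_lim (fun t => g (a * t)) t0 (l * a).
Proof.
move=> gl.
have inner : derivable_pt_lim (fun t => a * (t - t0)) t0 a.
  have -> : a = a * (1 - 0) by ring.
  have e : a * (1 - 0) = a by ring.
  rewrite {1}e; apply: derivable_pt_lim_scal.
  apply: derivable_pt_lim_minus; first exact: derivable_pt_lim_id.
  exact: derivable_pt_lim_const.
have gl' : derivable_pt_lim (fun s => g (a * t0 + s)) (a * (t0 - t0)) l.
  by have -> : a * (t0 - t0) = 0 by ring.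
apply: derivable_pt_lim_ext (derivable_pt_lim_comp _ _ _ _ _ inner gl') => t.
by rewrite /comp; congr g; ring.
Qed.

(** Parametrising the segment by the unit interval lets the mean value theorem apply whatever the
    sign of [a], zero included. *)
Lemma partial_mean_value Om g i (Dg : pt d -> R) x a :
  (forall y, Om y -> partial_at g i y (Dg y)) ->
  (forall t, 0 <= t <= 1 -> Om (line x (evec i) (a * t))) ->
  exists t, 0 <= t <= 1 /\
    g (line x (evec i) a) - g x = Dg (line x (evec i) (a * t)) * a.
Proof.
move=> gD inOm.
have [t|t [E ht]] := @MVT_cor2 (fun t => g (line x (evec i) (a * t)))
    (fun t => Dg (line x (evec i) (a * t)) * a) 0 1 Rlt_0_1.
  move=> ht; apply: (derivable_pt_lim_shift (g := fun s => g (line x (evec i) s))).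
  apply: derivable_pt_lim_ext (gD _ (inOm _ ht)) => s.
  by rewrite -line_line.
exists t; split; first lra.
by move: E; rewrite Rmult_1_r Rmult_0_r line0 => ->; ring.
Qed.

(* Move from z to z + s h one coordinate at a time and use the mean value
   theorem on each step; continuity of the partials controls the error. *)
Lemma derivable_line_at Om g (Dg : 'I_d -> pt d -> R) z h :
  open_dom Om -> (forall y i, Om y -> partial_at g i y (Dg i y)) ->
  (forall i, cont_on Om (Dg i)) -> Om z ->
  derivable_pt_lim (fun s => g (line z h s)) 0 (sumR (fun i => Dg i z * h i)).
Proof.
move=> Omo gD Dc Omz e e0.
pose H := sumR (fun i => Rabs (h i)).
have H0 : 0 <= H by apply: sumR_ge0 => i; apply: Rabs_pos.
(* The coordinate steps contribute at most [eta * H * Rabs s] in total, strictly below [e * Rabs s];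
   the [+ 1] covers [H = 0]. *)
pose eta := e / (H + 1).
have eta0 : 0 < eta by apply: Rdiv_lt_0_compat; lra.
have [r1 [r10 inOm]] := Omo z Omz.
have [r2 [r20 near_z]] : exists r, 0 < r /\ forall i y, Om y -> dist y z < r ->
    Rabs (Dg i y - Dg i z) < eta.
  apply: (common_radius (Q := fun i r => forall y, Om y -> dist y z < r ->
    Rabs (Dg i y - Dg i z) < eta)) => [i r s Qr sr y Oy yz|i].
    by apply: Qr => //; lra.
  exact: Dc.
pose r := Rmin r1 r2 / (norm2 h + 1).
have nh := norm2_ge0 h.
have r0 : 0 < r by apply: Rdiv_lt_0_compat; [exact: Rmin_pos | lra].
exists (mkposreal r r0) => s s0 /= sr.
have sh_small : Rabs s * norm2 h < Rmin r1 r2.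
  have : Rabs s * (norm2 h + 1) < Rmin r1 r2.
    have -> : Rmin r1 r2 = r * (norm2 h + 1) by rewrite /r; field; lra.
    by apply: Rmult_lt_compat_r; lra.
  by have := Rabs_pos s; lra.
(* In [y k] the coordinates of index below [k] have been moved, so [y 0] is [z] and [y d] is the
   endpoint. *)
pose w k : pt d := fun i => if (i < k)%N then s * h i else 0.
pose y k : pt d := fun i => z i + w k i.
have yS (k : 'I_d) : y k.+1 = line (y k) (evec k) (s * h k).
  apply: functional_extensionality => i; rewrite /y /w /line /evec ltnS leq_eqVlt.
  have [<-|ik] := eqVneq i k; first by rewrite eqxx ltnn /=; ring.
  by rewrite -val_eqE /= in ik; rewrite (negbTE ik) /=; ring.
have y_near (k : 'I_d) t : 0 <= t <= 1 ->
    dist (line (y k) (evec k) (s * h k * t)) z <= Rabs s * norm2 h.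
  move=> ht; rewrite -norm2_scal.
  have -> : line (y k) (evec k) (s * h k * t) =
      fun i => z i + (w k i + s * h k * t * evec k i).
    by apply: functional_extensionality => i; rewrite /line /y; ring.
  rewrite dist_add; apply: norm2_le => i; rewrite /w /evec.
  have [->|ik] := eqVneq i k.
    rewrite ltnn !(Rplus_0_l, Rmult_1_r) Rabs_mult (Rabs_right t); last lra.
    by have := Rabs_pos (s * h k); nra.
  rewrite Rmult_0_r Rplus_0_r; case: ifP => _; first lra.
  by rewrite Rabs_R0; apply: Rabs_pos.
have step (k : 'I_d) : Rabs (g (y k.+1) - g (y k) - s * (Dg k z * h k)) <=
    Rabs s * (eta * Rabs (h k)).
  have ballOm t : 0 <= t <= 1 -> Om (line (y k) (evec k) (s * h k * t)).
    move=> ht; apply: inOm; have := y_near k t ht.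
    by have := Rmin_l r1 r2; lra.
  rewrite yS.
  have [t [ht ->]] := partial_mean_value (fun y => gD y k) ballOm.
  set D1 := Dg k _.
  have -> : D1 * (s * h k) - s * (Dg k z * h k) = s * ((D1 - Dg k z) * h k) by ring.
  rewrite !Rabs_mult; apply: Rmult_le_compat_l; first exact: Rabs_pos.
  apply: Rmult_le_compat_r; first exact: Rabs_pos.
  apply: Rlt_le; apply: near_z; first exact: ballOm.
  by have := y_near k t ht; have := Rmin_r r1 r2; lra.
have tele : g (line z h s) - g z = sumR (fun k : 'I_d => g (y k.+1) - g (y k)).
  have -> : line z h s = y d.
    by apply: functional_extensionality => i; rewrite /y /w ltn_ord.
  have -> : g z = g (y 0%N).
    by congr g; apply: functional_extensionality => i; rewrite /y /w ltn0; ring.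
  rewrite /sumR -(big_mkord xpredT (fun k => g (y k.+1) - g (y k))).
  by have := telescope_sumr (fun k => g (y k)) (leq0n d) => /esym.
rewrite Rplus_0_l line0 tele.
have -> : sumR (fun k : 'I_d => g (y k.+1) - g (y k)) / s -
    sumR (fun i => Dg i z * h i) =
    sumR (fun k : 'I_d => g (y k.+1) - g (y k) - s * (Dg k z * h k)) / s.
  rewrite -(sumR_sub (fun k : 'I_d => g (y k.+1) - g (y k))) -sumR_scal.
  by field.
rewrite Rabs_mult Rabs_inv.
have as0 := Rabs_pos_lt _ s0.
apply: (Rmult_lt_reg_r (Rabs s)) => //.
rewrite Rmult_assoc Rinv_l ?Rmult_1_r; last lra.
apply: Rle_lt_trans (Rabs_sumR _) _.
apply: Rle_lt_trans (sumR_le step) _.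
rewrite -!sumR_scal -/H Rmult_comm; apply: Rmult_lt_compat_r => //.
have -> : e = eta * (H + 1) by rewrite /eta; field; lra.
nra.
Qed.

Lemma derivable_line Om g (Dg : 'I_d -> pt d -> R) x h t :
  open_dom Om -> (forall y i, Om y -> partial_at g i y (Dg i y)) ->
  (forall i, cont_on Om (Dg i)) -> Om (line x h t) ->
  derivable_pt_lim (fun s => g (line x h s)) t
    (sumR (fun i => Dg i (line x h t) * h i)).
Proof.
move=> Omo gD Dc Oml.
rewrite -[X in derivable_pt_lim _ _ X]Rmult_1_r.
have := derivable_pt_lim_shift (g := fun s => g (line x h s)) (a := 1) (t0 := t)
  (l := sumR (fun i => Dg i (line x h t) * h i)).
rewrite Rmult_1_l => shift.
apply: (derivable_pt_lim_ext (fun s => g (line x h (1 * s)))) => [s|].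
  by rewrite Rmult_1_l.
apply: shift; apply: derivable_pt_lim_ext (derivable_line_at h Omo gD Dc Oml) => s.
by rewrite line_line.
Qed.

Lemma derivable_pt_lim_sumR (F : 'I_d -> R -> R) (l : 'I_d -> R) t :
  (forall i, derivable_pt_lim (F i) t (l i)) ->
  derivable_pt_lim (fun s => sumR (fun i => F i s)) t (sumR l).
Proof.
move=> Fl; rewrite /sumR; elim: (index_enum _) => [|i s IH].
  rewrite big_nil; apply: derivable_pt_lim_ext (derivable_pt_lim_const 0 t) => u.
  by rewrite big_nil.
rewrite big_cons.
apply: derivable_pt_lim_ext (derivable_pt_lim_plus _ _ _ _ _ (Fl i) IH).
by move=> u; rewrite big_cons.
Qed.

(** Two uses of the mean value theorem give [psi 1 - psi 0 = psi2 u * t] with [0 < u < t < 1]. The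
    factor 1/2 of Taylor's formula is lost, harmlessly, since [taylor2] can make [c] as small as
    needed. *)
Lemma second_order_bound (psi psi1 psi2 : R -> R) c :
  (forall t, 0 <= t <= 1 -> derivable_pt_lim psi t (psi1 t)) ->
  (forall t, 0 <= t <= 1 -> derivable_pt_lim psi1 t (psi2 t)) ->
  (forall t, 0 <= t <= 1 -> Rabs (psi2 t) <= c) -> psi1 0 = 0 ->
  Rabs (psi 1 - psi 0) <= c.
Proof.
move=> d1 d2 bnd psi10.
have c0 : 0 <= c by apply: Rle_trans (bnd 0 _); [exact: Rabs_pos | lra].
have [t [-> ht]] := MVT_cor2 psi psi1 0 1 Rlt_0_1 d1.
have [u hu|u [E hu]] := MVT_cor2 psi1 psi2 0 t (proj1 ht) _.
  by apply: d2; lra.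
move: E; rewrite psi10 !Rminus_0_r => ->.
rewrite Rmult_1_r Rabs_mult (Rabs_right t); last lra.
have hu' : 0 <= u <= 1 by lra.
by have := bnd u hu'; have := Rabs_pos (psi2 u); nra.
Qed.

(** Along the segment, [psi] is [phi] minus the linear and quadratic Taylor terms. Its first
    derivative vanishes at 0, and its second is the form of the difference of two Hessians, small by
    continuity. *)
Lemma taylor2 Om phi Dphi D2phi x eta :
  open_dom Om -> C2_on Om phi Dphi D2phi -> Om x -> 0 < eta ->
  exists r, 0 < r /\ forall h, norm2 h < r ->
    Rabs (phi (line x h 1) - phi x - sumR (fun i => Dphi i x * h i)
          - quad (D2phi x) h / 2) <= eta * norm2 h ^ 2.
Proof.
move=> Omo [phiD [DphiD [_ [Dc D2c]]]] Omx eta0.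
have [r1 [r10 inOm]] := Omo x Omx.
(* The Hessian difference has [INR d * INR d] entries, each contributing at most
   [eta' * norm2 h ^ 2]; the [+ 1] keeps the denominator positive. *)
pose eta' := eta / (INR d * INR d + 1).
have nd := pos_INR d.
have eta'0 : 0 < eta' by apply: Rdiv_lt_0_compat; nra.
have etaE : eta = (INR d * INR d + 1) * eta' by rewrite /eta'; field; nra.
clearbody eta'.
have [r2 [r20 near_x]] : exists r, 0 < r /\ forall (ij : 'I_d * 'I_d) y,
    Om y -> dist y x < r -> Rabs (D2phi y ij.1 ij.2 - D2phi x ij.1 ij.2) < eta'.
  apply: (common_radius (Q := fun (ij : 'I_d * 'I_d) r => forall y, Om y ->
     dist y x < r -> Rabs (D2phi y ij.1 ij.2 - D2phi x ij.1 ij.2) < eta'))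
     => [ij r s Qr sr y Oy yx|ij].
    by apply: Qr => //; lra.
  exact: D2c.
exists (Rmin r1 r2); split=> [|h hr]; first exact: Rmin_pos.
have inB t : 0 <= t <= 1 -> dist (line x h t) x < Rmin r1 r2.
  by move=> ht; apply: dist_line_le => //; rewrite Rabs_right; lra.
have inO t : 0 <= t <= 1 -> Om (line x h t).
  by move=> ht; apply: inOm; have := inB t ht; have := Rmin_l r1 r2; lra.
set p := sumR _; set c := quad _ _.
pose psi t := phi (line x h t) - (t * p + t ^ 2 * (c / 2)).
pose psi1 t := sumR (fun i => Dphi i (line x h t) * h i) - (p + t * c).
pose psi2 t := quad (D2phi (line x h t)) h - c.
have -> : phi (line x h 1) - phi x - p - c / 2 = psi 1 - psi 0.
  by rewrite /psi line0; lra.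
apply: (second_order_bound (psi1 := psi1) (psi2 := psi2)).
- move=> t ht; apply: derivable_pt_lim_minus.
    exact: (derivable_line Omo phiD Dc (inO t ht)).
  have -> : p + t * c = 1 * p + t * 0 + ((INR 2 * t ^ 1) * (c / 2) + t ^ 2 * 0).
    by rewrite /=; field.
  apply: derivable_pt_lim_plus; apply: derivable_pt_lim_mult;
    try exact: derivable_pt_lim_const.
    exact: derivable_pt_lim_id.
  exact: derivable_pt_lim_pow.
- move=> t ht; apply: derivable_pt_lim_minus.
    apply: derivable_pt_lim_sumR => i.
    have -> : sumR (fun j => h i * D2phi (line x h t) i j * h j) =
        sumR (fun j => D2phi (line x h t) i j * h j) * h i +
        Dphi i (line x h t) * 0.
      by rewrite Rmult_0_r Rplus_0_r Rmult_comm sumR_scal; apply: sumR_ext => j; ring.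
    apply: derivable_pt_lim_mult; last exact: derivable_pt_lim_const.
    apply: (derivable_line (g := Dphi i) (Dg := fun j y => D2phi y i j) Omo _ _
      (inO t ht)) => [y j Oy|j]; last exact: D2c.
    exact: DphiD.
  have e : c = 0 + (1 * c + t * 0) by ring.
  rewrite {2}e; apply: derivable_pt_lim_plus; first exact: derivable_pt_lim_const.
  apply: derivable_pt_lim_mult; last exact: derivable_pt_lim_const.
  exact: derivable_pt_lim_id.
- move=> t ht.
  have -> : psi2 t = sumR (fun i => sumR (fun j =>
      h i * (D2phi (line x h t) i j - D2phi x i j) * h j)).
    rewrite /psi2 /c /quad sumR_sub; apply: sumR_ext => i.
    by rewrite sumR_sub; apply: sumR_ext => j; ring.
  have n0 := norm2_ge0 h.
  apply: (Rle_trans _ (sumR (fun i : 'I_d => sumR (fun j : 'I_d => eta' * norm2 h ^ 2)))).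
    apply: Rle_trans (Rabs_sumR _) _; apply: sumR_le => i.
    apply: Rle_trans (Rabs_sumR _) _; apply: sumR_le => j.
    rewrite !Rabs_mult.
    have hd : Rabs (D2phi (line x h t) i j - D2phi x i j) <= eta'.
      apply: Rlt_le; apply: (near_x (i, j)); first exact: inO.
      by have := inB t ht; have := Rmin_r r1 r2; lra.
    have hi := Rabs_le_norm2 h i; have hj := Rabs_le_norm2 h j.
    have -> : eta' * norm2 h ^ 2 = norm2 h * eta' * norm2 h by ring.
    apply: Rmult_le_compat => //; try exact: Rabs_pos.
      by apply: Rmult_le_pos; apply: Rabs_pos.
    by apply: Rmult_le_compat => //; apply: Rabs_pos.
  rewrite !sumR_const etaE -!(Rmult_assoc _ _ (norm2 h ^ 2)).
  by apply: Rmult_le_compat_r; nra.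
- by rewrite /psi1 line0 /p; lra.
Qed.

End Lines.

(** * Quadratic test functions and their contact with C2 functions *)

Section QuadraticTestFunctions.
Variable d : nat.
Implicit Types (x y v h p : pt d) (Q A B : mat d) (Om : pt d -> Prop).

(** A quadratic in Taylor form about [x]: value [c], gradient [p] and, when [Q] is symmetric,
    Hessian [Q]. *)
Definition qfun c p Q x y : R :=
  c + sumR (fun i => p i * (y i - x i)) + quad Q (fun i => y i - x i) / 2.

Lemma quad_scal Q h t : quad Q (fun i => t * h i) = t ^ 2 * quad Q h.
Proof.
rewrite /quad sumR_scal; apply: sumR_ext => i; rewrite sumR_scal.
by apply: sumR_ext => j; ring.
Qed.

Lemma qfun_line c p Q x h t :
  qfun c p Q x (line x h t) =
  c + t * sumR (fun i => p i * h i) + t ^ 2 * (quad Q h / 2).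
Proof.
have E : (fun i => line x h t i - x i) = (fun i => t * h i).
  by apply: functional_extensionality => i; rewrite /line; ring.
rewrite /qfun E quad_scal sumR_scal.
have -> : sumR (fun i => p i * (line x h t i - x i)) = sumR (fun i => t * (p i * h i)).
  by apply: sumR_ext => i; rewrite /line; ring.
by field.
Qed.

Lemma qfun_center c p Q x : qfun c p Q x x = c.
Proof. by rewrite -{2}(line0 x x) qfun_line; ring. Qed.

(** Symmetry of [Q] makes the two mixed terms equal, whence the factor 2. *)
Lemma quad_line Q v h t : symmetric Q ->
  quad Q (fun i => v i + t * h i) = quad Q v +
    2 * t * sumR (fun i => h i * sumR (fun j => Q i j * v j)) + t ^ 2 * quad Q h.
Proof.
move=> Qs.
have cross : sumR (fun i => sumR (fun j => v i * Q i j * h j)) =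
    sumR (fun i => h i * sumR (fun j => Q i j * v j)).
  rewrite sumR_exchange; apply: sumR_ext => i; rewrite sumR_scal.
  by apply: sumR_ext => j; rewrite (Qs j i); ring.
have -> : 2 * t * sumR (fun i => h i * sumR (fun j => Q i j * v j)) =
    t * sumR (fun i => h i * sumR (fun j => Q i j * v j)) +
    t * sumR (fun i => sumR (fun j => v i * Q i j * h j)) by rewrite cross; ring.
rewrite /quad !sumR_scal !sumR_add; apply: sumR_ext => i.
rewrite !sumR_scal !sumR_add; apply: sumR_ext => j; ring.
Qed.

(** The affine part cancels, and the convexity defect of the form is [t * (1 - t)] times its value
    at [y - z]. *)
Lemma qfun_convex Om c p Q x : psd Q -> convex_fun_on Om (qfun c p Q x).
Proof.
move=> [_ Qpos] y z t _ _ ht; rewrite /qfun.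
have -> : sumR (fun i => p i * (lin y z t i - x i)) =
    (1 - t) * sumR (fun i => p i * (y i - x i)) + t * sumR (fun i => p i * (z i - x i)).
  by rewrite !sumR_scal sumR_add; apply: sumR_ext => i; rewrite /lin; ring.
have -> : quad Q (fun i => lin y z t i - x i) =
    (1 - t) * quad Q (fun i => y i - x i) + t * quad Q (fun i => z i - x i)
    - t * (1 - t) * quad Q (fun i => y i - z i).
  rewrite /quad !sumR_scal !sumR_add sumR_sub; apply: sumR_ext => i.
  rewrite !sumR_scal !sumR_add sumR_sub; apply: sumR_ext => j.
  by rewrite /lin; ring.
have tt : 0 <= t * (1 - t) by nra.
by have := Rmult_le_pos _ _ tt (Qpos (fun i => y i - z i)); rewrite -/(quad _ _); lra.
Qed.

Lemma cont_on_const Om c : cont_on Om (fun _ => c).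
Proof.
move=> x _ e e0; exists 1; split=> [|y _ _]; first lra.
by rewrite Rminus_diag Rabs_R0.
Qed.

Lemma cont_on_proj Om i : cont_on Om (fun y => y i).
Proof.
move=> x _ e e0; exists e; split=> // y _.
by apply: Rle_lt_trans; apply: (Rabs_le_norm2 (fun k => y k - x k)).
Qed.

Lemma cont_on_add Om g1 g2 :
  cont_on Om g1 -> cont_on Om g2 -> cont_on Om (fun y => g1 y + g2 y).
Proof.
move=> c1 c2 x Ox e e0.
have e20 : 0 < e / 2 by lra.
have [r1 [r10 h1]] := c1 x Ox _ e20; have [r2 [r20 h2]] := c2 x Ox _ e20.
exists (Rmin r1 r2); split=> [|y Oy yx]; first exact: Rmin_pos.
have := h1 y Oy (Rlt_le_trans _ _ _ yx (Rmin_l _ _)).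
have := h2 y Oy (Rlt_le_trans _ _ _ yx (Rmin_r _ _)).
have -> : g1 y + g2 y - (g1 x + g2 x) = (g1 y - g1 x) + (g2 y - g2 x) by ring.
by have := Rabs_triang (g1 y - g1 x) (g2 y - g2 x); lra.
Qed.

Lemma cont_on_mul Om g1 g2 :
  cont_on Om g1 -> cont_on Om g2 -> cont_on Om (fun y => g1 y * g2 y).
Proof.
move=> c1 c2 x Ox e e0.
(* The three error terms sum to less than [eta * (eta + Rabs (g1 x) + Rabs (g2 x))], which is at
   most [eta * m] because [eta <= 1]. *)
pose m := Rabs (g1 x) + Rabs (g2 x) + 1.
have p1 := Rabs_pos (g1 x); have p2 := Rabs_pos (g2 x).
have m0 : 0 < m by rewrite /m; lra.
pose eta := Rmin 1 (e / m).
have em0 : 0 < e / m by apply: Rdiv_lt_0_compat.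
have eta0 : 0 < eta by apply: Rmin_pos; lra.
have etam : eta * m <= e.
  have -> : e = e / m * m by field; lra.
  by apply: Rmult_le_compat_r; [lra | exact: Rmin_r].
have eta1 : eta <= 1 by apply: Rmin_l.
have [r1 [r10 h1]] := c1 x Ox _ eta0; have [r2 [r20 h2]] := c2 x Ox _ eta0.
exists (Rmin r1 r2); split=> [|y Oy yx]; first exact: Rmin_pos.
have := h1 y Oy (Rlt_le_trans _ _ _ yx (Rmin_l _ _)).
have := h2 y Oy (Rlt_le_trans _ _ _ yx (Rmin_r _ _)).
have -> : g1 y * g2 y - g1 x * g2 x =
  (g1 y - g1 x) * (g2 y - g2 x) + (g1 x * (g2 y - g2 x) + (g1 y - g1 x) * g2 x) by ring.
move=> l2 l1.
apply: Rle_lt_trans (Rabs_triang _ _) _.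
have := Rabs_triang (g1 x * (g2 y - g2 x)) ((g1 y - g1 x) * g2 x).
rewrite !Rabs_mult.
have q1 := Rabs_pos (g1 y - g1 x); have q2 := Rabs_pos (g2 y - g2 x).
move: etam; rewrite /m; nra.
Qed.

Lemma cont_on_sumR Om (F : 'I_d -> pt d -> R) :
  (forall i, cont_on Om (F i)) -> cont_on Om (fun y => sumR (fun i => F i y)).
Proof.
move=> Fc; rewrite /sumR; elim: (index_enum _) => [|i s IH].
  have -> : (fun y => \big[Rplus/0]_(i <- [::]) F i y) = (fun _ => 0).
    by apply: functional_extensionality => y; rewrite big_nil.
  exact: cont_on_const.
have -> : (fun y => \big[Rplus/0]_(j <- i :: s) F j y) =
    (fun y => F i y + \big[Rplus/0]_(j <- s) F j y).
  by apply: functional_extensionality => y; rewrite big_cons.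
exact: cont_on_add.
Qed.

Lemma cont_on_qfun Om c p Q x : cont_on Om (qfun c p Q x).
Proof.
have cd i : cont_on Om (fun y => y i - x i).
  by apply: cont_on_add; [exact: cont_on_proj | exact: cont_on_const].
apply: cont_on_add.
  apply: cont_on_add; first exact: cont_on_const.
  by apply: cont_on_sumR => i; apply: cont_on_mul => //; exact: cont_on_const.
apply: cont_on_mul; last exact: cont_on_const.
apply: cont_on_sumR => i; apply: cont_on_sumR => j.
apply: cont_on_mul => //; apply: cont_on_mul => //; exact: cont_on_const.
Qed.

(** On a coordinate line [qfun] is a quadratic polynomial in the parameter, whose linear coefficient
    [l] is the partial derivative; the gradient is affine, with slope [Q]. *)
Lemma qfun_C2 Om c p Q x : symmetric Q ->
  C2_on Om (qfun c p Q x)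
    (fun i y => p i + sumR (fun j => Q i j * (y j - x j))) (fun _ => Q).
Proof.
move=> Qs.
have cd i : cont_on Om (fun y => y i - x i).
  by apply: cont_on_add; [exact: cont_on_proj | exact: cont_on_const].
split; [|split; [|split; [|split]]].
- move=> y i _; rewrite /partial_at -/(line y (evec i)).
  set l := p i + _; set m := quad Q (evec i) / 2.
  have E t : qfun c p Q x (line y (evec i) t) = qfun c p Q x y + (t * l + t ^ 2 * m).
    have e : (fun k => line y (evec i) t k - x k) =
             (fun k => (y k - x k) + t * evec i k).
      by apply: functional_extensionality => k; rewrite /line; ring.
    rewrite /qfun e quad_line // sumR_evec.
    have -> : sumR (fun k => p k * (line y (evec i) t k - x k)) =
        sumR (fun k => p k * (y k - x k)) + t * p i.
      rewrite -(sumR_evec i p) sumR_scal sumR_add; apply: sumR_ext => k.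
      by rewrite /line; ring.
    by rewrite /l /m; field.
  apply: (derivable_pt_lim_ext (fun t => qfun c p Q x y + (t * l + t ^ 2 * m))).
    by move=> t; rewrite -E.
  have el : l = 0 + (1 * l + 0 * 0 + (INR 2 * 0 ^ 1 * m + 0 ^ 2 * 0)) by simpl; ring.
  rewrite {2}el; apply: derivable_pt_lim_plus; first exact: derivable_pt_lim_const.
  apply: derivable_pt_lim_plus; apply: derivable_pt_lim_mult;
    try exact: derivable_pt_lim_const.
    exact: derivable_pt_lim_id.
  exact: derivable_pt_lim_pow.
- move=> y i j _; rewrite /partial_at.
  set s := p i + sumR (fun k => Q i k * (y k - x k)).
  apply: (derivable_pt_lim_ext (fun t => s + t * Q i j)).
    move=> t; rewrite -(sumR_evec j (Q i)) sumR_scal /s Rplus_assoc sumR_add.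
    by congr Rplus; apply: sumR_ext => k; ring.
  have e : Q i j = 0 + (1 * Q i j + 0 * 0) by ring.
  rewrite {2}e; apply: derivable_pt_lim_plus; first exact: derivable_pt_lim_const.
  apply: derivable_pt_lim_mult; last exact: derivable_pt_lim_const.
  exact: derivable_pt_lim_id.
- exact: cont_on_qfun.
- move=> i; apply: cont_on_add; first exact: cont_on_const.
  by apply: cont_on_sumR => j; apply: cont_on_mul => //; exact: cont_on_const.
- by move=> i j; exact: cont_on_const.
Qed.

(* Working with the symmetric part of A makes Schwarz's theorem for D2phi
   unnecessary: both H and the second-order Taylor term only see it. *)
Definition symshift A e : mat d :=
  fun i j => (A i j + A j i) / 2 + (if i == j then e else 0).

Lemma symshift_sym A e : symmetric (symshift A e).
Proof. by move=> i j; rewrite /symshift (eq_sym j i) (Rplus_comm (A j i)). Qed.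

Lemma sumR_diag (F : 'I_d -> R) e i :
  sumR (fun j => (if i == j then e else 0) * F j) = e * F i.
Proof.
rewrite -(sumR_evec i F) sumR_scal; apply: sumR_ext => j.
by rewrite /evec (eq_sym j i); case: (i == j); ring.
Qed.

Lemma quad_symshift A e h : quad (symshift A e) h = quad A h + e * norm2 h ^ 2.
Proof.
have tr : quad A h = sumR (fun i => sumR (fun j => h i * A j i * h j)).
  rewrite /quad sumR_exchange; apply: sumR_ext => i; apply: sumR_ext => j; ring.
have -> : quad A h = / 2 * quad A h + / 2 * quad A h by field.
rewrite {2}tr /quad norm2_sqr !sumR_scal !sumR_add; apply: sumR_ext => i.
have -> : e * (h i * h i) = sumR (fun j => (if i == j then e else 0) * (h i * h j)).
  by rewrite sumR_diag.
rewrite !sumR_scal !sumR_add; apply: sumR_ext => j; rewrite /symshift; field.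
Qed.

(** For [B] in [S1] the trace is 1, so a shift of the Hessian by [e] changes [Hval] by exactly
    [- e]. *)
Lemma frob_symshift A B e : symmetric B ->
  frob B (symshift A e) = frob B A + e * trace B.
Proof.
move=> Bs.
have tr : frob B A = sumR (fun i => sumR (fun j => B i j * A j i)).
  rewrite /frob sumR_exchange; apply: sumR_ext => i; apply: sumR_ext => j.
  by rewrite Bs.
have -> : frob B A = / 2 * frob B A + / 2 * frob B A by field.
rewrite {2}tr /frob /trace !sumR_scal !sumR_add; apply: sumR_ext => i.
have -> : e * B i i = sumR (fun j => (if i == j then e else 0) * B i j).
  by rewrite sumR_diag.
rewrite !sumR_scal !sumR_add; apply: sumR_ext => j; rewrite /symshift; field.
Qed.

(** Shifting the Hessian by [e] adds [e / 2 * norm2 h ^ 2] to the quadratic, which dominates a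
    Taylor remainder taken with constant [e / 2]. *)
Lemma C2_quadratic_bounds Om phi Dphi D2phi x e :
  open_dom Om -> C2_on Om phi Dphi D2phi -> Om x -> 0 < e ->
  let q s := qfun (phi x) (fun i => Dphi i x) (symshift (D2phi x) s) x in
  exists r, 0 < r /\ forall y, dist y x < r -> q (- e) y <= phi y <= q e y.
Proof.
move=> Omo phiC Ox e0 q.
have e20 : 0 < e / 2 by lra.
have [r [r0 T]] := taylor2 Omo phiC Ox e20.
exists r; split=> // y yx.
have := T (fun k => y k - x k) yx; rewrite line_sub /q /qfun !quad_symshift.
by split_Rabs; lra.
Qed.

End QuadraticTestFunctions.

(** * The Bellman operator: existence of the supremum and bounds from determinants *)

Section BellmanOperator.
Variable d : nat.
Hypothesis d_gt0 : (0 < d)%N.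
Implicit Types (A B : mat d) (f : R).

Definition mx A : 'M[R]_d := (\matrix_(i, j) A i j)%R.

Lemma det_mx A : Defs.det A = (\det (mx A))%R.
Proof.
apply: eq_bigr => s _; congr Rmult; first by case: (odd_perm s).
by apply: eq_bigr => i _; rewrite mxE.
Qed.

Lemma trace_mx A : Defs.trace A = (\tr (mx A))%R.
Proof. by apply: eq_bigr => i _; rewrite mxE. Qed.

Lemma quad_mx A (v : 'rV[R]_d) :
  quad A (fun i => v ord0 i) = ((v *m mx A *m v^T) ord0 ord0)%R.
Proof.
rewrite /quad sumR_exchange mxE; apply: eq_bigr => j _.
rewrite !mxE mulr_suml; apply: eq_bigr => i _.
by rewrite mxE.
Qed.

Lemma psd_mx A : psd A <-> psdmx (mx A).
Proof.
split=> -[As Apos]; split.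
- by apply/matrixP => i j; rewrite !mxE.
- by move=> v; rewrite -quad_mx; apply/RleP/Apos.
- by move=> i j; move/matrixP/(_ j i): As; rewrite !mxE.
- move=> v; rewrite -/(quad A v).
  have -> : v = fun i => (\row_j v j)%R ord0 i.
    by apply: functional_extensionality => i; rewrite mxE.
  by rewrite quad_mx; apply/RleP.
Qed.

Lemma frob_mx A B : symmetric A -> frob B A = (\tr (mx B *m mx A))%R.
Proof.
move=> As; apply: eq_bigr => i _; rewrite mxE; apply: eq_bigr => j _.
by rewrite !mxE (As i j).
Qed.

Lemma mx_of_fun (M : 'M[R]_d) : mx (fun i j => M i j) = M.
Proof. by apply/matrixP => i j; rewrite mxE. Qed.

Lemma INR_d_gt0 : 0 < INR d.
Proof. by apply: lt_0_INR; apply/ssrnat.ltP. Qed.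

Lemma root_ge0 x : 0 <= root d x.
Proof.
rewrite /root; case: (Rle_dec x 0) => ? /=; first lra.
exact/Rlt_le/exp_pos.
Qed.

Lemma root_pow x : 0 <= x -> root d x ^ d = x.
Proof.
move=> x0; rewrite /root; case: (Rle_dec x 0) => [x0'|/Rnot_le_lt xpos] /=.
  (* Here [x = 0] and [root] returns its default value 0; [0 ^ d] is 0 because [d] is positive. *)
  by rewrite pow_ne_zero; [lra | move=> d0; move: d_gt0; rewrite {1}d0].
rewrite -Rpower_pow; last exact: exp_pos.
rewrite Rpower_mult Rinv_l ?Rpower_1 //.
by have := INR_d_gt0; lra.
Qed.

Lemma pow_le_inv a b : 0 <= a -> 0 <= b -> a ^ d <= b ^ d -> a <= b.
Proof.
move=> a0 b0 /RleP; rewrite !RpowE ler_pXn2r //; last 2 first.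
- exact/RleP.
- exact/RleP.
by move/RleP.
Qed.

(** Multiplying the hypothesis by the determinant of [B] and using [psdmx_det_mul_le_trace] bounds
    the d-th power of [f / INR d * root d (det B)] by that of [frob B A / INR d]; then take
    roots. *)
Lemma root_det_le_frob A B f : psd A -> psd B -> 0 <= f ->
  (f / INR d) ^ d <= Defs.det A -> f * root d (Defs.det B) <= frob B A.
Proof.
move=> Apsd Bpsd f0 fA.
have [/RleP t0 /RleP amgm] := psdmx_det_mul_le_trace
  (proj1 (psd_mx B) Bpsd) (proj1 (psd_mx A) Apsd).
rewrite -frob_mx in t0 amgm; last exact: (proj1 Apsd).
rewrite -!det_mx -INRE -RpowE in amgm.
have B0 : 0 <= Defs.det B.
  by rewrite det_mx; apply/RleP/psdmx_det_ge0/psd_mx.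
have n0 := INR_d_gt0; have r0 := root_ge0 (Defs.det B).
suff : f / INR d * root d (Defs.det B) <= frob B A / INR d.
  move=> /(Rmult_le_compat_r (INR d) _ _ (Rlt_le _ _ n0)).
  have -> : f / INR d * root d (Defs.det B) * INR d = f * root d (Defs.det B).
    by field; lra.
  by have -> : frob B A / INR d * INR d = frob B A by field; lra.
have fd0 : 0 <= f / INR d by apply: Rle_mult_inv_pos.
apply: pow_le_inv.
- exact: Rmult_le_pos.
- exact: Rle_mult_inv_pos.
rewrite Rpow_mult_distr root_pow //; apply: Rle_trans amgm.
by rewrite Rmult_comm; apply: Rmult_le_compat_l.
Qed.

(** A crude constant suffices: it gives a shift making [A] positive semidefinite, and it shows that
    a vector with negative form has nonzero norm. *)
Lemma quad_ge A (v : pt d) :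
  - (sumR (fun i => sumR (fun j => Rabs (A i j))) * norm2 v ^ 2) <= quad A v.
Proof.
suff : Rabs (quad A v) <= sumR (fun i => sumR (fun j => Rabs (A i j))) * norm2 v ^ 2.
  by split_Rabs; lra.
rewrite Rmult_comm sumR_scal; apply: Rle_trans (Rabs_sumR _) _; apply: sumR_le => i.
rewrite sumR_scal; apply: Rle_trans (Rabs_sumR _) _; apply: sumR_le => j.
rewrite !Rabs_mult.
have := Rabs_le_norm2 v i; have := Rabs_le_norm2 v j.
have := Rabs_pos (v i); have := Rabs_pos (v j); have := Rabs_pos (A i j).
move=> a0 vj0 vi0 vj vi.
have : Rabs (v i) * Rabs (v j) <= norm2 v * norm2 v by apply: Rmult_le_compat.
by nra.
Qed.

Lemma Hval_bounded A f B : 0 <= f -> S1 B ->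
  Hval A f B <= sumR (fun i => sumR (fun j => Rabs (A i j))) + f / INR d.
Proof.
move=> f0 [Bpsd trB].
have n0 := INR_d_gt0.
have fd0 : 0 <= f / INR d by apply: Rle_mult_inv_pos.
set C := sumR _.
have C0 : 0 <= C by apply: sumR_ge0 => i; apply: sumR_ge0 => j; exact: Rabs_pos.
(* The symmetric part of [A] shifted by [C] is positive semidefinite, and so has a nonnegative trace
   product with [B]. *)
have frob_ge : 0 <= frob B A + C.
  have Psd : psd (symshift A C).
    split; first exact: symshift_sym.
    move=> v; rewrite -/(quad _ v) quad_symshift.
    by have := quad_ge A v; rewrite -/C; lra.
  have [/RleP tr0 _] :=
    psdmx_det_mul_le_trace (proj1 (psd_mx B) Bpsd) (proj1 (psd_mx _) Psd).
  have : 0 <= frob B (symshift A C) by rewrite frob_mx //; exact: symshift_sym.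
  by rewrite frob_symshift; [rewrite trB; lra | exact: (proj1 Bpsd)].
have root_le : f * root d (Defs.det B) <= f / INR d.
  have [s fE] : exists s, f / INR d = s by exists (f / INR d).
  rewrite fE in fd0 *.
  (* [I] is [s] times the identity: its determinant is [(f / INR d) ^ d], and its Frobenius product
     with [B] is [s] because [B] has trace 1. *)
  pose I : mat d := symshift (fun _ _ => 0) s.
  have mI : mx I = (s%:M)%R.
    apply/matrixP => i j; rewrite !mxE /I /symshift; case: (i == j) => /=.
      by rewrite mulr1n; lra.
    by rewrite mulr0n; change (GRing.zero : R) with 0; lra.
  have Ipsd : psd I by apply/psd_mx; rewrite mI; apply: psdmx_scalar; apply/RleP.
  have dI : (f / INR d) ^ d <= Defs.det I.
    by rewrite fE det_mx mI det_scalar RpowE; apply: Rle_refl.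
  have := root_det_le_frob Ipsd Bpsd f0 dI.
  rewrite frob_symshift; last exact: (proj1 Bpsd).
  have -> : frob B (fun _ _ => 0) = 0.
    by rewrite /frob; apply: big1 => i _; apply: big1 => j _; ring.
  by rewrite trB; lra.
by rewrite /Hval; lra.
Qed.

Lemma S1_nonempty : exists B, S1 B.
Proof.
have [B [_ [Bpsd trB _ _ _]]] := psdmx_dual d_gt0
  (psdmx_scalar d (ler01 : (0 <= 1 :> R)%R))
  (ltac:(by rewrite det1 ltr01) : (0 < \det (1%:M : 'M[R]_d))%R).
exists (fun i j => B i j); split; first by apply/psd_mx; rewrite mx_of_fun.
by rewrite trace_mx mx_of_fun.
Qed.

(** The choice operator in [Hop] returns the supremum only once a least upper bound is known to
    exist; [Hval_bounded] and [S1_nonempty] provide one. *)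
Lemma Hop_lub A f : 0 <= f ->
  is_lub (fun r => exists B, S1 B /\ r = Hval A f B) (Hop A f).
Proof.
move=> f0; rewrite /Hop; apply: epsilon_spec.
have bnd : bound (fun r => exists B, S1 B /\ r = Hval A f B).
  exists (sumR (fun i => sumR (fun j => Rabs (A i j))) + f / INR d).
  by move=> _ [B [B1 ->]]; exact: Hval_bounded.
have [|s s_lub] := completeness _ bnd; last by exists s.
by have [B B1] := S1_nonempty; exists (Hval A f B), B.
Qed.

Lemma Hop_le A f c : 0 <= f -> (forall B, S1 B -> Hval A f B <= c) -> Hop A f <= c.
Proof.
by move=> f0 Hc; apply: (proj2 (Hop_lub A f0)) => _ [B [B1 ->]]; exact: Hc.
Qed.

Lemma Hop_ge A f B : 0 <= f -> S1 B -> Hval A f B <= Hop A f.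
Proof. by move=> f0 B1; apply: (proj1 (Hop_lub A f0)); exists B. Qed.

(** The matrix from [psdmx_dual] gives equality in the trace-determinant inequality: [frob B A] is
    [INR d * t], where [t ^ d] is the product of the determinants, hence at most the d-th power of
    [f / INR d * root d (det B)]. *)
Lemma S1_dual_witness A f : 0 <= f -> psd A -> 0 < Defs.det A ->
  Defs.det A <= (f / INR d) ^ d ->
  exists2 B, S1 B & frob B A <= f * root d (Defs.det B).
Proof.
move=> f0 Apsd dA fA; have n0 := INR_d_gt0.
have dA' : (0 < \det (mx A))%R by rewrite -det_mx; apply/RltP.
have [M [t [Mpsd trM /RltP t0 trMA dMA]]] :=
  psdmx_dual d_gt0 (proj1 (psd_mx A) Apsd) dA'.
pose B : mat d := fun i j => M i j.
have EB : mx B = M by apply: mx_of_fun.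
have Bpsd : psd B by apply/psd_mx; rewrite EB.
exists B; first by split=> //; rewrite trace_mx EB.
rewrite frob_mx; last exact: (proj1 Apsd).
rewrite EB trMA -INRE.
have dB0 : 0 <= Defs.det B by rewrite det_mx; apply/RleP/psdmx_det_ge0/psd_mx.
suff : t <= f / INR d * root d (Defs.det B).
  move=> /(Rmult_le_compat_l (INR d) _ _ (Rlt_le _ _ n0)).
  have -> // : INR d * (f / INR d * root d (Defs.det B)) = f * root d (Defs.det B).
  by field; lra.
apply: pow_le_inv; first exact: Rlt_le.
  by apply: Rmult_le_pos; [exact: Rle_mult_inv_pos | exact: root_ge0].
rewrite Rpow_mult_distr root_pow // RpowE -dMA -EB -!det_mx Rmult_comm.
by apply: Rmult_le_compat_l.
Qed.

(** The witness is the orthogonal projection onto the line of [v], which turns a Rayleigh quotient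
    of [A] into a Frobenius product. *)
Lemma rank_one_S1 A (v : pt d) : 0 < norm2 v ^ 2 ->
  exists2 B, S1 B & frob B A = quad A v / norm2 v ^ 2.
Proof.
move=> v0; pose n := norm2 v ^ 2.
pose B : mat d := fun i j => / n * (v i * v j).
have EB : mx B = (/ n *: ((\col_i v i) *m (\col_i v i)^T))%R.
  by apply/matrixP => i j; rewrite !mxE big_ord1 !mxE.
exists B.
  split.
    apply/psd_mx; rewrite EB; apply: psdmx_scale; last exact: psdmx_mul_tr.
    by apply/RleP/Rlt_le/Rinv_0_lt_compat.
  by rewrite /trace /B -sumR_scal -norm2_sqr -/n Rinv_l // /n; lra.
rewrite /frob /quad /Rdiv Rmult_comm sumR_scal; apply: sumR_ext => i.
by rewrite sumR_scal; apply: sumR_ext => j; rewrite /B /n; ring.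
Qed.

End BellmanOperator.

(** * From convex test functions to arbitrary ones *)

Lemma visc_sub_of_convex d (Om : pt d -> Prop) (f u : pt d -> R) :
  (0 < d)%N -> open_dom Om -> (forall x, Om x -> 0 <= f x) ->
  visc_sub_convex Om (fun A x => Mop A (f x)) u ->
  visc_sub Om (fun A x => Hop A (f x)) u.
Proof.
move=> d0 Omo fpos [uc [uconv usub]]; split=> //.
move=> phi Dphi D2phi x phiC Ox [r1 [r10 umax]].
apply: Hop_le => // [|B [Bpsd trB]]; first exact: fpos.
apply: Rle_plus_epsilon => e e0; rewrite Rplus_0_l.
have [r2 [r20 near_x]] := C2_quadratic_bounds Omo phiC Ox e0.
have [r3 [r30 inOm]] := Omo x Ox.
set p := fun i => Dphi i x; pose Q := symshift (D2phi x) e.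
pose q := qfun (phi x) p Q x.
have qx : q x = phi x by apply: qfun_center.
pose r := Rmin r1 r2.
have r0 : 0 < r by apply: Rmin_pos.
have qmax y : Om y -> dist y x < r -> u y - q y <= u x - q x.
  move=> Oy yx; have := Rmin_l r1 r2; have := Rmin_r r1 r2; rewrite -/r => l2 l1.
  have yr1 : dist y x < r1 by lra.
  have yr2 : dist y x < r2 by lra.
  have /= := umax y Oy yr1; have : phi y <= q y := proj2 (near_x y yr2).
  by rewrite qx; lra.
(* If [quad Q h < 0], averaging the contact inequality at [x + t h] and [x - t h] bounds the mean of
   [u] there by [u x + t ^ 2 * quad Q h / 2], below [u x], against the convexity of [u]. *)
have Qpsd : psd Q.
  split=> [|h]; first exact: symshift_sym.
  rewrite -/(quad Q h); apply: Rnot_lt_le => Qh.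
  have nh := norm2_ge0 h.
  pose t := Rmin r r3 / (norm2 h + 1).
  have rr0 : 0 < Rmin r r3 by apply: Rmin_pos.
  have t0 : 0 < t by apply: Rdiv_lt_0_compat; lra.
  have tn : t * norm2 h < Rmin r r3.
    have -> : Rmin r r3 = t * (norm2 h + 1) by rewrite /t; field; lra.
    by nra.
  have near s : Rabs s = t -> Om (line x h s) /\ dist (line x h s) x < r.
    move=> hs; have := dist_line x h s; rewrite hs => E.
    have := Rmin_l r r3; have := Rmin_r r r3.
    by split; [apply: inOm|]; lra.
  have abst : Rabs t = t by apply: Rabs_right; lra.
  have [O1 b1] := near t abst.
  have [O2 b2] := near (- t) (eq_trans (Rabs_Ropp t) abst).
  have half : 0 <= / 2 <= 1 by lra.
  have := uconv _ _ _ O2 O1 half.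
  have -> : lin (line x h (- t)) (line x h t) (/ 2) = x.
    by apply: functional_extensionality => k; rewrite /lin /line; field.
  have := qmax _ O1 b1; have := qmax _ O2 b2.
  rewrite qx /q !qfun_line.
  have : 0 < t ^ 2 * (- quad Q h) by apply: Rmult_lt_0_compat; nra.
  by nra.
have := usub q _ _ x (qfun_C2 Om (phi x) p x (symshift_sym (D2phi x) e))
  (@qfun_convex _ Om (phi x) p Q x Qpsd) Ox (ex_intro _ r (conj r0 qmax)).
rewrite /Mop => MQ.
have fQ : (f x / INR d) ^ d <= Defs.det Q by rewrite /Q; lra.
have := root_det_le_frob d0 Qpsd Bpsd (fpos x Ox) fQ.
rewrite frob_symshift; last exact: (proj1 Bpsd).
by rewrite /Hval trB; lra.
Qed.

Lemma visc_super_of_convex d (Om : pt d -> Prop) (f u : pt d -> R) :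
  (0 < d)%N -> open_dom Om -> (forall x, Om x -> 0 <= f x) ->
  visc_super_convex Om (fun A x => Mop A (f x)) u ->
  visc_super Om (fun A x => Hop A (f x)) u.
Proof.
move=> d0 Omo fpos [uc [uconv usup]]; split=> //.
move=> phi Dphi D2phi x phiC Ox [r1 [r10 umin]].
have fx0 := fpos x Ox.
set A := D2phi x.
(* The supremum is nonnegative as soon as it is at least [- e] for every positive [e], so one matrix
   [B] per [e] is enough. *)
suff bound e : 0 < e -> exists2 B, S1 B & - e <= Hval A (f x) B.
  apply: Rle_plus_epsilon => e /bound[B B1 HB].
  by have := Hop_ge d0 A fx0 B1; lra.
move=> e0; case: (classic (psd (symshift A (- e)))) => [Apsd|nApsd]; last first.
  have [v Av] : exists v, quad (symshift A (- e)) v < 0.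
    apply: NNPP => nv; apply: nApsd; split=> [|v]; first exact: symshift_sym.
    by apply: Rnot_lt_le => Av; apply: nv; exists v.
  have v0 : 0 < norm2 v ^ 2.
    have n0 := norm2_ge0 v.
    case: (Rle_lt_or_eq_dec 0 (norm2 v) n0) => [|v0]; first nra.
    have := quad_ge (symshift A (- e)) v.
    by rewrite -v0; nra.
  move: Av; rewrite quad_symshift => Av.
  have [B B1 EB] := rank_one_S1 A v0; exists B => //.
  (* The determinant term of [Hval] is nonnegative, so it remains to bound the Rayleigh quotient by
     [e]. *)
  have := Rmult_le_pos _ _ fx0 (root_ge0 d (Defs.det B)).
  rewrite /Hval EB.
  suff : quad A v / norm2 v ^ 2 <= e by lra.
  apply: (Rmult_le_reg_r (norm2 v ^ 2)) => //.
  by rewrite /Rdiv Rmult_assoc Rinv_l; lra.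
(* The margin [e] is split in two: one [s] lets the quadratic touch [phi] from below, and the other
   keeps [Q - s I] positive semidefinite, so that [Q] has positive determinant and can be
   inverted. *)
have [s es] : exists s, e = 2 * s by exists (e / 2); field.
have s0 : 0 < s by lra.
have [r2 [r20 near_x]] := C2_quadratic_bounds Omo phiC Ox s0.
set p := fun i => Dphi i x; pose Q := symshift A (- s).
pose q := qfun (phi x) p Q x.
have qx : q x = phi x by apply: qfun_center.
have qmin : loc_min Om (fun y => u y - q y) x.
  exists (Rmin r1 r2); split=> [|y Oy yx]; first exact: Rmin_pos.
  have := Rmin_l r1 r2; have := Rmin_r r1 r2 => l2 l1.
  have yr1 : dist y x < r1 by lra.
  have yr2 : dist y x < r2 by lra.
  have /= := umin y Oy yr1; have : q y <= phi y := proj1 (near_x y yr2).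
  by rewrite qx; lra.
have Qpsd : psd Q.
  split=> [|v]; first exact: symshift_sym.
  have := proj2 Apsd v; rewrite -!/(quad _ v) !quad_symshift.
  by have := norm2_ge0 v; nra.
have detQ : 0 < Defs.det Q.
  rewrite det_mx; apply/RltP; apply: (@psdmx_det_gt0 _ _ _ s); first exact/RltP.
  have <- : mx (symshift A (- e)) = (mx Q - s%:M)%R; last exact/psd_mx.
  apply/matrixP => i j; rewrite !mxE -RminusE /Q /symshift es; case: (i == j) => /=.
    by rewrite mulr1n; lra.
  by rewrite mulr0n; exact/esym/subr0.
have := usup q _ _ x (qfun_C2 Om (phi x) p x (symshift_sym A (- s)))
  (@qfun_convex _ Om (phi x) p Q x Qpsd) Ox qmin.
rewrite /Mop => MQ.
have fQ : Defs.det Q <= (f x / INR d) ^ d by rewrite /Q; lra.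
have [B B1 HB] := S1_dual_witness d0 fx0 Qpsd detQ fQ.
exists B => //; move: HB; rewrite frob_symshift; last exact: (proj1 (proj1 B1)).
by rewrite (proj2 B1) /Hval; lra.
Qed.

Theorem theorem3p3 (d : nat) (Om : pt d -> Prop) (f : pt d -> R) :
  (2 <= d)%N ->
  nonempty_set Om -> open_dom Om -> bounded_dom Om -> strictly_convex_domain Om ->
  cont_on Om f -> (forall x, Om x -> 0 <= f x) ->
  (forall u : pt d -> R,
     visc_sub_convex Om (fun A x => Mop A (f x)) u ->
     visc_sub Om (fun A x => Hop A (f x)) u) /\
  (forall u : pt d -> R,
     visc_super_convex Om (fun A x => Mop A (f x)) u ->
     visc_super Om (fun A x => Hop A (f x)) u).
Proof.
move=> d2 _ Omo _ _ _ fpos; have d0 : (0 < d)%N by apply: leq_trans d2.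
by split=> u; [exact: visc_sub_of_convex | exact: visc_super_of_convex].
Qed.
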